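(* Suppose that $\mathcal{Q}$ is convex and that for all $d\in\mathcal{D}$ the cost function $C(q,d)$ is convex in $q$. Suppose that there is a re-parametrization from the space $\boldsymbol y\in\mathcal{Y}$ to $(\hat\theta,\boldsymbol y|\hat\theta)\in\Theta\times\mathcal{D}^{N-o}$, where $\boldsymbol y|\hat\theta$ denotes some parametrization of the restriction $\{\boldsymbol y:\hat\theta(\boldsymbol y)=\hat\theta\}$ for given $\hat\theta$, and that the Jacobian $J(\hat\theta,\boldsymbol y|\hat\theta)$ of this change of variables exists and is non-negative for all $\hat\theta\in\Theta$ and $\boldsymbol y|\hat\theta\in\mathcal{D}^{N-o}$. Then, for a given localization $u$, there exists some MLE-sufficient prescriptive solution $\tilde q(\cdot)\in\mathcal{Q}^{\mathcal{S}}$ that is out-of-sample locally optimal about $u$, i.e. that minimizes $\Psi[\,\cdot\,;u]$ over all prescriptive solutions.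
   Context: Setting. $\mathcal{Q}\subseteq\mathbb{R}$ is the feasible set of decisions $q$. The uncertain variable $d$ takes values in an outcome space $\mathcal{D}$ (with reference measure written $dd$), and $C(q,d)$ is a real-valued cost function. The hypothesis set, which contains the true distribution of $d$, is a given family of probability densities $\{f(\cdot;\theta):\theta\in\Theta\}$ on $\mathcal{D}$ with $\Theta\subseteq\mathbb{R}^o$. The expected cost is $\phi(q;\theta):=\int_{\mathcal{D}}C(q,d)f(d;\theta)\,dd$. Data. A data set of size $N$ is $\boldsymbol y=(y_1,\dots,y_N)\in\mathcal{Y}:=\mathcal{D}^N$, consisting of i.i.d. samples from $f(\cdot;\theta)$, with joint density $g(\boldsymbol y;\theta):=\prod_{n=1}^N f(y_n;\theta)$. A prescriptive solution is a function $\boldsymbol y\mapsto q(\boldsymbol y)$ from $\mathcal{Y}$ to $\mathbb{R}$, feasible in the sense that $q(\boldsymbol y)\in\mathcal{Q}$, with no explicit dependence on $\theta$. Localization and performance. A localization $u$ is a probability density on $\Theta$. The expected out-of-sample performance of $q(\cdot)$ with respect to $u$ is $$\Psi[q(\cdot);u]:=\int_\Theta\int_{\mathcal{Y}}\int_{\mathcal{D}}C(q(\boldsymbol y),d)\,f(d;\theta)\,g(\boldsymbol y;\theta)\,u(\theta)\,dd\,d\boldsymbol y\,d\theta .$$ A prescriptive solution is out-of-sample locally optimal about $u$ if it minimizes $\Psi[\,\cdot\,;u]$ over prescriptive solutions. Sufficient statistic. $\hat\theta:\mathcal{Y}\to\Theta$ is the maximum likelihood estimator (MLE), $\hat\theta(\boldsymbol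 y)$ maximizing $g(\boldsymbol y;\theta)$ over $\theta\in\Theta$. It is assumed to be a sufficient statistic, so there are non-negative functions $g_0,g_1$ with $g(\boldsymbol y;\theta)=g_0(\boldsymbol y)\,g_1(\hat\theta(\boldsymbol y),\theta)$ for all $\boldsymbol y\in\mathcal{Y}$, $\theta\in\Theta$. A prescriptive solution is MLE-sufficient if it depends explicitly on $\boldsymbol y$ only through $\hat\theta(\boldsymbol y)$, i.e. it can be written $q(\hat\theta(\boldsymbol y))$; $\mathcal{Q}^{\mathcal{S}}$ is the class of these. Change of variables. The re-parametrization with Jacobian $J$ means that $$\int_{\mathcal{Y}}h(\boldsymbol y)\,d\boldsymbol y=\int_\Theta\int_{\{\boldsymbol y:\hat\theta(\boldsymbol y)=\hat\theta\}}h(\hat\theta,\boldsymbol y|\hat\theta)\,J(\hat\theta,\boldsymbol y|\hat\theta)\,d(\boldsymbol y|\hat\theta)\,d\hat\theta,$$ where $h(\hat\theta,\boldsymbol y|\hat\theta)$ denotes $h$ in the new coordinates. Convention. All functions are measurable, and the integrals written are assumed to be well defined with interchange of the order of integration permitted.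
   Formalization: It is additionally assumed that some prescriptive solution is out-of-sample locally optimal about u, since otherwise no minimizer need exist (e.g. Q = R, C(q,d) = exp(q)); ''well defined'' is read as: the negative part of the integrand of Ψ[q;u] has finite integral for every prescriptive q. *)

(* Defs.v *)
From HB Require Import structures.
From mathcomp Require Import all_boot all_order all_algebra.
From mathcomp Require Import all_classical all_reals all_analysis.
From mathcomp Require Import measurable_realfun.

Set Implicit Arguments.
Unset Strict Implicit.
Unset Printing Implicit Defensive.

Import Order.TTheory GRing.Theory Num.Theory.
Import numFieldNormedType.Exports.

Local Open Scope classical_set_scope.
Local Open Scope ring_scope.

(* The n-fold product of a sigma-finite measure, on n-tuples. It is used for
   dy on D^N, for d(y|theta) on D^(N-o), and for Lebesgue measure on R^o. *)
Definition tuple_cons T n (x : T * n.-tuple T) : n.+1.-tuple T :=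
  [tuple of x.1 :: x.2].

Lemma measurable_tuple_cons d (T : measurableType d) n :
  measurable_fun [set: T * n.-tuple T] (@tuple_cons T n).
Proof. exact: measurable_cons. Qed.

Section tuple_measureS.
Context d (T : measurableType d) (R : realType) (n : nat).
Variables (mu : {sigma_finite_measure set T -> \bar R})
  (nu : {sigma_finite_measure set (n.-tuple T) -> \bar R}).

Definition tuple_measureS : set (n.+1.-tuple T) -> \bar R :=
  pushforward (mu \x nu)%E (@tuple_cons T n).

Let mcons := @measurable_tuple_cons d T n.

Let tuple_measureS0 : tuple_measureS set0 = 0%E.
Proof. exact: measure0. Qed.

Let tuple_measureS_ge0 A : (0 <= tuple_measureS A)%E.
Proof. exact: measure_ge0. Qed.

Let tuple_measureS_sigma_additive : semi_sigma_additive tuple_measureS.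
Proof. exact: measure_semi_sigma_additive. Qed.

HB.instance Definition _ := isMeasure.Build _ _ _ tuple_measureS
  tuple_measureS0 tuple_measureS_ge0 tuple_measureS_sigma_additive.

Let tuple_measureS_sigma_finite : sigma_finite setT tuple_measureS.
Proof.
have /sigma_finiteP[F [TF ndF Foo]] := sigma_finiteT mu.
have /sigma_finiteP[G [TG ndG Goo]] := sigma_finiteT nu.
pose uncons (z : n.+1.-tuple T) : T * n.-tuple T :=
  (tnth z ord0, [tuple of behead z]).
have consK : cancel (@tuple_cons T n) uncons.
  by case=> x t; rewrite /uncons /tuple_cons/=; congr pair; exact: val_inj.
have muncons : measurable_fun setT uncons.
  by apply: measurable_fun_pair; [exact: measurable_tnth|exact: measurable_behead].
exists (fun i => uncons @^-1` (F i `*` G i)).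
  rewrite -preimage_bigcup (_ : \bigcup_i _ = setT) ?preimage_setT//.
  apply/seteqP; split=> // -[x y] _ /=.
  have [l _ Flx] : (\bigcup_i F i) x by rewrite -TF.
  have [k _ Gky] : (\bigcup_i G i) y by rewrite -TG.
  exists (maxn l k) => //; split=> /=.
  - by move: x Flx; exact/subsetPset/ndF/leq_maxl.
  - by move: y Gky; exact/subsetPset/ndG/leq_maxr.
move=> i; have [mF Fi] := Foo i; have [mG Gi] := Goo i; split.
  by rewrite -[X in measurable X]setTI; apply: muncons => //; exact: measurableX.
rewrite /tuple_measureS /pushforward -comp_preimage.
rewrite (_ : uncons \o _ = id); last by apply/funext => x /=; rewrite consK.
by rewrite preimage_id product_measure1E// lte_mul_pinfty// ge0_fin_numE.
Qed.

HB.instance Definition _ := Measure_isSigmaFinite.Build _ _ _ tuple_measureS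
  tuple_measureS_sigma_finite.

End tuple_measureS.

Fixpoint tuple_measure d (T : measurableType d) (R : realType)
    (mu : {sigma_finite_measure set T -> \bar R}) (n : nat) :
    {sigma_finite_measure set (n.-tuple T) -> \bar R} :=
  match n with
  | 0 => \d_([tuple] : 0.-tuple T)
  | m.+1 => tuple_measureS mu (tuple_measure mu m)
  end.

Notation Euclid R o := (o.-tuple (measurableTypeR R)).

Definition Euclid_lebesgue (R : realType) (o : nat) :
    {sigma_finite_measure set (Euclid R o) -> \bar R} :=
  tuple_measure (@lebesgue_measure R) o.

Section setting.
Context d (D : measurableType d) (R : realType) (o N : nat).
Variables (nu : {sigma_finite_measure set D -> \bar R}) (Theta : set (Euclid R o)).
Variables (f : D -> Euclid R o -> R) (C : R -> D -> R) (Q : set R).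
Implicit Types (t : Euclid R o) (y : N.-tuple D) (x : D) (q : N.-tuple D -> R).

Definition is_density d' (T : measurableType d')
    (mu : set T -> \bar R) (A : set T) (p : T -> R) :=
  [/\ measurable_fun A p, (forall s, A s -> 0 <= p s) &
      (\int[mu]_(s in A) (p s)%:E = 1)%E].

Definition likelihood y t : R := \prod_(n < N) f (tnth y n) t.

Definition is_MLE (thetahat : N.-tuple D -> Euclid R o) :=
  forall y, Theta (thetahat y) /\
    forall t, Theta t -> likelihood y t <= likelihood y (thetahat y).

Definition sufficient_factorization (thetahat : N.-tuple D -> Euclid R o)
    (g0 : N.-tuple D -> R) (g1 : Euclid R o -> Euclid R o -> R) :=
  [/\ forall y, 0 <= g0 y,
      forall s t, Theta s -> Theta t -> 0 <= g1 s t &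
      forall y t, Theta t -> likelihood y t = g0 y * g1 (thetahat y) t].

Definition prescriptive q := measurable_fun setT q /\ forall y, Q (q y).

Definition MLE_sufficient (thetahat : N.-tuple D -> Euclid R o) q :=
  prescriptive q /\
  exists2 qt : Euclid R o -> R,
    measurable_fun Theta qt & forall y, q y = qt (thetahat y).

Definition Psi_integrand (u : Euclid R o -> R) q t y x : R :=
  C (q y) x * f x t * likelihood y t * u t.

Definition Psi (u : Euclid R o -> R) q : \bar R :=
  (\int[Euclid_lebesgue R o]_(t in Theta) \int[tuple_measure nu N]_y
     \int[nu]_x (Psi_integrand u q t y x)%:E)%E.

(* The negative part of the integrand has a finite integral, so that Psi u q is
   a well-defined element of ]-oo, +oo] and the order of integration is
   immaterial; automatic for instance if C is bounded below. *)
Definition Psi_well_defined (u : Euclid R o -> R) q :=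
  (\int[Euclid_lebesgue R o]_(t in Theta) \int[tuple_measure nu N]_y
     \int[nu]_x (Num.max (- Psi_integrand u q t y x) 0)%:E < +oo)%E.

Definition locally_optimal (u : Euclid R o -> R) q :=
  prescriptive q /\ forall q', prescriptive q' -> (Psi u q <= Psi u q')%E.

(* A point of D^N with estimate t has coordinates (t, z), z : D^(N-o), and
   eta (t, z) is the point with these coordinates. The coordinates range over a
   subset W of Theta x D^(N-o), possibly all of it: even in standard models,
   the fibre of the estimator over t need not fill D^(N-o). *)
Record reparametrization (thetahat : N.-tuple D -> Euclid R o)
    (W : set (Euclid R o * (N - o).-tuple D))
    (eta : Euclid R o * (N - o).-tuple D -> N.-tuple D)
    (J : Euclid R o * (N - o).-tuple D -> R) : Prop := {
  reparam_dom : measurable W /\ W `<=` Theta `*` setT ;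
  reparam_meas : measurable_fun W eta ;
  reparam_fibre : forall t, Theta t ->
    set_bij (xsection W t) [set y | thetahat y = t] (fun z => eta (t, z)) ;
  jacobian_meas : measurable_fun W J ;
  jacobian_ge0 : forall w, W w -> 0 <= J w ;
  change_of_variables : forall h : N.-tuple D -> \bar R,
    measurable_fun setT h -> (forall y, 0 <= h y)%E ->
    (\int[tuple_measure nu N]_y h y =
     \int[Euclid_lebesgue R o]_(t in Theta)
       \int[tuple_measure nu (N - o)]_(z in xsection W t)
         (h (eta (t, z)) * (J (t, z))%:E))%E }.

End setting.

(* Main.v *)
(* Writing C = C^+ - C^-, Tonelli's theorem, the factorization g = g0 * g1 and the
   change of variables turn Psi[q; u] into an integral over (s, z) of
   Gamma(s, q(s, z)) * w(s, z), where w = g0 * J and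
     Gamma(s, r) = \int C(r, x) f(x; t) g1(s, t) u(t) d(t, x)
   is convex in r and does not depend on the fibre coordinate z. On the fibre over
   s, the points where Gamma(s, q(s, z)) is at most its w-average form a set A_s of
   positive mass. A quasi-arithmetic mean b(s) of q over A_s lies between two values
   that q takes on A_s, so Gamma(s, b(s)) is at most that average by convexity. The
   policy b(thetahat(y)) is therefore at least as good as q. Averaging q itself, as
   in Jensen's inequality, would require q to be integrable along the fibres. *)
Require Import Defs.
From HB Require Import structures.
From mathcomp Require Import all_boot all_order all_algebra.
From mathcomp Require Import all_classical all_reals all_analysis.
From mathcomp Require Import measurable_realfun.
From mathcomp Require Import ring lra.

Set Implicit Arguments.
Unset Strict Implicit.
Unset Printing Implicit Defensive.

Import Order.TTheory GRing.Theory Num.Theory.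
Import numFieldNormedType.Exports.

Local Open Scope classical_set_scope.
Local Open Scope ring_scope.

(** * Weighted means *)

Section integral_lemmas.
Local Open Scope ereal_scope.
Context d (T : measurableType d) (R : realType) (mu : {measure set T -> \bar R}).

Lemma ge0_integral_eq0_ae (f : T -> \bar R) : measurable_fun setT f ->
  (forall x, 0 <= f x) -> \int[mu]_x f x = 0 -> {ae mu, forall x, f x = 0}.
Proof.
move=> mf f0 if0.
have : \int[mu]_x `|f x| = 0.
  by rewrite -[RHS]if0; apply: eq_integral => x _; rewrite gee0_abs.
move/(ae_eq_integral_abs mu measurableT mf).
by apply: filterS => x; apply.
Qed.

Lemma ge0_integral_lty_ae (f : T -> \bar R) : measurable_fun setT f ->
  (forall x, 0 <= f x) -> \int[mu]_x f x < +oo -> {ae mu, forall x, f x < +oo}.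
Proof.
move=> mf f0 ify.
have : mu.-integrable setT f.
  apply/integrableP; split=> //; rewrite (le_lt_trans _ ify)//.
  by apply: ge0_le_integral => //;
    [exact: measurableT_comp|move=> x _; rewrite gee0_abs].
move/(integrable_ae measurableT).
by apply: filterS => x /(_ I); rewrite ge0_fin_numE.
Qed.

Lemma ae0_ge0_integral (f : T -> \bar R) : measurable_fun setT f ->
  (forall x, 0 <= f x) -> {ae mu, forall x, f x = 0} -> \int[mu]_x f x = 0.
Proof.
move=> mf f0 ff; rewrite (@ge0_ae_eq_integral _ _ _ mu _ _ (cst 0))//.
  by rewrite integral_cst// mul0e.
by apply: filterS ff => x fx _.
Qed.

(** Only [g] has to be integrable. If [f] has infinite integral, the negative part of [f - g] is
    still bounded by [g], and [f <= (f - g)^+ + g] forces the positive part to have infinite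
    integral, so both sides are [+oo]. *)
Lemma ge0_integralB (f g : T -> \bar R) :
  measurable_fun setT f -> measurable_fun setT g ->
  (forall x, 0 <= f x) -> (forall x, 0 <= g x) -> \int[mu]_x g x < +oo ->
  \int[mu]_x (f x - g x) = \int[mu]_x f x - \int[mu]_x g x.
Proof.
move=> mf mg f0 g0 gy.
have ig : mu.-integrable setT g.
  apply/integrableP; split=> //; rewrite (le_lt_trans _ gy)//.
  by apply: ge0_le_integral => //;
    [exact: measurableT_comp|move=> x _; rewrite gee0_abs].
have [fy|] := ltP (\int[mu]_x f x) +oo.
  apply: integralB => //.
  apply/integrableP; split=> //; rewrite (le_lt_trans _ fy)//.
  by apply: ge0_le_integral => //;
    [exact: measurableT_comp|move=> x _; rewrite gee0_abs].
rewrite leye_eq => /eqP fy.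
have mfg : measurable_fun setT (f \- g) by exact: emeasurable_funB.
have gfin : \int[mu]_x g x \is a fin_num by rewrite ge0_fin_numE// integral_ge0.
rewrite fy addye; last by rewrite -fin_numN in gfin; case: (- _) gfin.
rewrite integralE.
have neg : \int[mu]_x (fun x => f x - g x)^\- x \is a fin_num.
  rewrite ge0_fin_numE ?integral_ge0// (le_lt_trans _ gy)//.
  apply: ge0_le_integral => //; first exact: measurable_funeneg.
  move=> x _; rewrite funenegE ge_max g0 andbT.
  case: (f x) (g x) (f0 x) (g0 x) => [a| |] [b| |]//=;
    rewrite ?lee_fin; move=> a0 b0; rewrite ?leey ?leNye//.
  by rewrite opprB lerBlDr lerDl.
suff -> : \int[mu]_x (fun x => f x - g x)^\+ x = +oo.
  by rewrite addye//; rewrite -fin_numN in neg; case: (- _) neg.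
apply/eqP; rewrite -leye_eq leNgt; apply/negP => posy.
suff : \int[mu]_x f x < +oo by rewrite fy.
rewrite (@le_lt_trans _ _ (\int[mu]_x ((fun x => f x - g x)^\+ x + g x)))//.
  apply: ge0_le_integral => //.
  - by apply: emeasurable_funD => //; exact: measurable_funepos.
  - move=> x _; rewrite funeposE.
    case: (f x) (g x) (f0 x) (g0 x) => [a| |] [b| |]//=.
    + by move=> _ _; rewrite -EFin_max -EFinD lee_fin -lerBlDr le_max lexx.
    + by move=> _ _; rewrite addeNy max_r ?leNye// add0e leey.
    + by move=> _ _; rewrite addeNy max_r ?leNye.
rewrite ge0_integralD//; last exact: measurable_funepos.
by rewrite lte_add_pinfty.
Qed.

End integral_lemmas.

Section weighted_mean.
Context d (T : measurableType d) (R : realType) (mu : {measure set T -> \bar R}).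
Variables w h : T -> R.
Hypotheses (mw : measurable_fun setT w) (mh : measurable_fun setT h).
Hypothesis w0 : forall x, 0 <= w x.
Hypothesis iw : (\int[mu]_x (w x)%:E < +oo)%E.

(** With [m] the integral of [w] and [c] that of [w * h], the function [w * (m * h - c)] has
    integral [m * c - c * m = 0]. Were it positive wherever [w] is, it would vanish almost
    everywhere, and [w] with it. *)
Lemma weighted_mean_not_lt :
  mu.-integrable setT (EFin \o (fun x => w x * h x)) ->
  (\int[mu]_x (w x)%:E != 0)%E ->
  ~ {ae mu, forall x, 0 < w x ->
       Rintegral mu setT (fun x => w x * h x) < Rintegral mu setT w * h x}.
Proof.
move=> iwh wn0 lt_h.
set m := Rintegral mu setT w; set c := Rintegral mu setT _ in lt_h.
have iw' : mu.-integrable setT (EFin \o w).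
  apply/integrableP; split; first exact/measurable_EFinP.
  by under eq_integral do rewrite /= ger0_norm//.
pose g x := m * (w x * h x) - c * w x.
have ig : mu.-integrable setT (EFin \o g).
  apply: (integrableB measurableT (f := EFin \o (fun x => m * (w x * h x)))
     (g := EFin \o (fun x => c * w x))) => //.
  - exact: (integrableZl measurableT m iwh).
  - exact: (integrableZl measurableT c iw').
have ig0 : Rintegral mu setT g = 0.
  rewrite /g RintegralB//.
  - by rewrite !RintegralZl// -/m -/c mulrC subrr.
  - exact: (integrableZl measurableT m iwh).
  - exact: (integrableZl measurableT c iw').
have gE x : g x = w x * (m * h x - c) by rewrite /g; ring.
have aeg0 : {ae mu, forall x, (`|g x|)%:E = (g x)%:E}.
  apply: filterS lt_h => x hx; congr EFin; rewrite ger0_norm// gE.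
  have := w0 x; rewrite le_eqVlt => /predU1P[<-|wx]; first by rewrite mul0r.
  by rewrite mulr_ge0// subr_ge0 ltW// hx.
have /integrableP[/measurable_EFinP mg _] := ig.
have ig1 : (\int[mu]_x (`|g x|)%:E = 0)%E.
  rewrite (ae_eq_integral (EFin \o g))//.
  - by rewrite -[LHS]fineK ?integrable_fin_num// -/(Rintegral mu setT g) ig0.
  - by apply/measurable_EFinP; exact: measurableT_comp.
  - exact/measurable_EFinP.
  - by apply: filterS aeg0 => x ->.
have aeg : {ae mu, forall x, (`|g x|)%:E = 0%E}.
  apply: ge0_integral_eq0_ae => //.
  by apply/measurable_EFinP; exact: measurableT_comp.
move/eqP : wn0; apply; apply: ae0_ge0_integral => //.
  exact/measurable_EFinP.
apply: filterS2 lt_h aeg => x hx [/eqP]; rewrite normr_eq0 gE mulf_eq0.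
have := w0 x; rewrite le_eqVlt => /predU1P[<-//|wx].
by rewrite gt_eqF//= subr_eq0 gt_eqF// hx.
Qed.

End weighted_mean.

Section quasi_mean.
Context d (T : measurableType d) (R : realType) (mu : {measure set T -> \bar R}).

(* The weights [w * min 1 (expR a)] and [w * min 1 (expR (- a))] are integrable
   without any assumption on [a], and their quotient is [expR a]. *)
Definition quasi_mean (w a : T -> R) : R :=
  ln (fine (\int[mu]_x (w x * Num.min 1 (expR (a x)))%:E)) -
  ln (fine (\int[mu]_x (w x * Num.min 1 (expR (- a x)))%:E)).

Lemma quasi_meanN (w a : T -> R) :
  quasi_mean w (fun x => - a x) = - quasi_mean w a.
Proof.
rewrite /quasi_mean opprB.
by congr (_ - ln (fine _)); apply: eq_integral => x _; rewrite opprK.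
Qed.

Variables w a : T -> R.
Hypotheses (mw : measurable_fun setT w) (ma : measurable_fun setT a).
Hypothesis w0 : forall x, 0 <= w x.
Hypothesis iw : (\int[mu]_x (w x)%:E < +oo)%E.
Hypothesis iwn0 : (\int[mu]_x (w x)%:E != 0)%E.

Let v (e : T -> R) x := w x * Num.min 1 (expR (e x)).

Let min_gt0 (r : R) : 0 < Num.min 1 (expR r).
Proof. by rewrite lt_min ltr01 expR_gt0. Qed.

Let v0 e x : 0 <= v e x. Proof. by rewrite mulr_ge0// ltW. Qed.

Let mv e : measurable_fun setT e -> measurable_fun setT (v e).
Proof.
move=> me; apply: measurable_funM => //; apply: measurable_minr => //.
exact: measurableT_comp.
Qed.

Let iv e : measurable_fun setT e -> (\int[mu]_x (v e x)%:E < +oo)%E.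
Proof.
move=> me; apply: le_lt_trans iw; apply: ge0_le_integral => //.
- by move=> x _; rewrite lee_fin.
- by apply/measurable_EFinP; exact: mv.
- exact/measurable_EFinP.
- by move=> x _; rewrite lee_fin ler_piMr// ge_min lexx.
Qed.

Let iv_gt0 e : measurable_fun setT e -> 0 < fine (\int[mu]_x (v e x)%:E)%E.
Proof.
move=> me; rewrite fine_gt0// iv// andbT lt0e integral_ge0 ?andbT//; last first.
  by move=> x _; rewrite lee_fin.
apply/eqP => /ge0_integral_eq0_ae H; move/eqP : iwn0; apply.
apply: ae0_ge0_integral => //; first exact/measurable_EFinP.
have : {ae mu, forall x, (v e x)%:E = 0%E}.
  by apply: H; [apply/measurable_EFinP; exact: mv|move=> x; rewrite lee_fin].
apply: filterS => x [] /eqP.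
by rewrite mulf_eq0 [X in _ || X]gt_eqF ?orbF => [/eqP ->|].
Qed.

(** Since [min 1 (expR (- a)) * expR a = min 1 (expR a)], the exponential of the quasi-mean is the
    mean of [expR a] for the weight [w * min 1 (expR (- a))]. If [a] exceeded the quasi-mean
    wherever [w] is positive, [expR a] would exceed its own mean there. *)
Lemma le_quasi_mean : exists2 x, 0 < w x & a x <= quasi_mean w a.
Proof.
apply/not_exists2P => /= nex.
have mNa : measurable_fun setT (fun x => - a x) by exact: measurableT_comp.
have vE x : v (fun x => - a x) x * expR (a x) = v a x.
  rewrite /v -mulrA; congr (_ * _).
  have [a0|/ltW a0] := leP 0 (a x).
    rewrite [X in X * _]min_r -?expR0 ?ler_expR ?oppr_le0//.
    by rewrite -expRD addNr min_l ?ler_expR.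
  rewrite [X in X * _]min_l -?expR0 ?ler_expR ?oppr_ge0//.
  by rewrite -expRD add0r min_r ?ler_expR.
apply: (@weighted_mean_not_lt _ _ _ mu (v (fun x => - a x)) (expR \o a)).
- exact: mv.
- by move=> x.
- exact: iv.
- apply/integrableP; split.
    apply/measurable_EFinP; rewrite (_ : (fun x => _) = v a); first exact: mv.
    by apply/funext => x; rewrite /= vE.
  under eq_integral do rewrite /= vE ger0_norm//.
  exact: iv.
- by apply/eqP => i0; have := iv_gt0 mNa; rewrite i0 ltxx.
apply/aeW => x vx.
have wx : 0 < w x.
  by rewrite lt_neqAle w0 andbT; apply: contraTneq vx => wx0; rewrite /v -wx0 mul0r ltxx.
have [//|] := nex x; move=> /negP; rewrite -ltNge => ltx.
have vaE : Rintegral mu setT (fun x => v (fun x => - a x) x * (expR \o a) x) =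
   fine (\int[mu]_x (v a x)%:E)%E.
  by congr fine; apply: eq_integral => z _; rewrite /= vE.
rewrite vaE /= -ltr_pdivrMl ?iv_gt0//.
rewrite -[X in X < _]lnK ?posrE ?divr_gt0 ?mulr_gt0 ?invr_gt0 ?iv_gt0// ltr_expR.
by rewrite lnM ?posrE ?invr_gt0 ?iv_gt0// lnV ?posrE ?iv_gt0// addrC.
Qed.

End quasi_mean.

(** The mirror image of [le_quasi_mean], by oddness of the quasi-mean in [a]. *)
Lemma ge_quasi_mean d (T : measurableType d) (R : realType)
    (mu : {measure set T -> \bar R}) (w a : T -> R) :
  measurable_fun setT w -> measurable_fun setT a -> (forall x, 0 <= w x) ->
  (\int[mu]_x (w x)%:E < +oo)%E -> (\int[mu]_x (w x)%:E != 0)%E ->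
  exists2 x, 0 < w x & quasi_mean mu w a <= a x.
Proof.
move=> mw ma w0 iw iwn0.
have mNa : measurable_fun setT (fun x => - a x) by exact: measurableT_comp.
have [x wx] := le_quasi_mean mw mNa w0 iw iwn0.
by rewrite quasi_meanN lerN2; exists x.
Qed.

(** * Points whose cost does not exceed the weighted average *)

Section below_average.
Context d (T : measurableType d) (R : realType) (mu : {measure set T -> \bar R}).
Local Open Scope ereal_scope.

(* [p - n <= (kp - kn) / m] without division and without [+oo - +oo]. *)
Definition below_average (m kp kn p n : \bar R) : bool :=
  [&& p < +oo, n < +oo & m * p + kn <= m * n + kp].

Variables (w : T -> R) (p n : T -> \bar R).
Hypotheses (mw : measurable_fun setT w) (w0 : forall x, (0 <= w x)%R).
Hypotheses (mp : measurable_fun setT p) (p0 : forall x, 0 <= p x).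
Hypotheses (mn : measurable_fun setT n) (n0 : forall x, 0 <= n x).

Let m := \int[mu]_x (w x)%:E.
Let kp := \int[mu]_x ((w x)%:E * p x).
Let kn := \int[mu]_x ((w x)%:E * n x).

Hypotheses (m_gt0 : 0 < m) (my : m < +oo) (kpy : kp < +oo) (kny : kn < +oo).

Let mEw : measurable_fun setT (EFin \o w).
Proof. exact/measurable_EFinP. Qed.

(** A finite integral makes [w * f] finite almost everywhere, hence [f] finite almost everywhere on
    [0 < w]; where [w] is zero, both products are zero. *)
Let integral_fine (f : T -> \bar R) : measurable_fun setT f ->
  (forall x, 0 <= f x) -> \int[mu]_x ((w x)%:E * f x) < +oo ->
  mu.-integrable setT (EFin \o (fun x => w x * fine (f x))%R) /\
  \int[mu]_x (w x * fine (f x))%:E = \int[mu]_x ((w x)%:E * f x).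
Proof.
move=> mf f0 iwf.
have mwf : measurable_fun setT (fun x => (w x)%:E * f x) by exact: emeasurable_funM.
have mwff : measurable_fun setT (fun x => w x * fine (f x))%R.
  by apply: measurable_funM => //; exact: measurableT_comp.
have wf0 x : 0 <= (w x)%:E * f x by rewrite mule_ge0// lee_fin.
have E : \int[mu]_x (w x * fine (f x))%:E = \int[mu]_x ((w x)%:E * f x).
  apply: ge0_ae_eq_integral => //; first exact/measurable_EFinP.
    move=> x _; by rewrite lee_fin mulr_ge0// fine_ge0.
  apply: filterS (ge0_integral_lty_ae mwf wf0 iwf) => x + _.
  case: (f x) (f0 x) => [r _ _| |]//.
  move=> _ /=; have := w0 x; rewrite le_eqVlt => /predU1P[<-|wx].
    by rewrite mul0e mul0r.
  by rewrite gt0_muley ?lte_fin// ltxx.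
split=> //; apply/integrableP; split; first exact/measurable_EFinP.
under eq_integral do rewrite /= ger0_norm ?mulr_ge0 ?fine_ge0//.
by rewrite E.
Qed.

(** Almost everywhere on [0 < w] both [p] and [n] are finite. If the below-average points had no
    weight, [m * (p - n)] would exceed [kp - kn] almost everywhere there, against
    [weighted_mean_not_lt] for [h = p - n]. *)
Lemma below_average_weight_neq0 :
  \int[mu]_x (if below_average m kp kn (p x) (n x) then w x else 0%R)%:E != 0.
Proof.
apply/eqP => iA0.
have mb : measurable_fun setT (fun x => below_average m kp kn (p x) (n x)).
  apply: measurable_and; first exact: measurable_fun_lte.
  apply: measurable_and; first exact: measurable_fun_lte.
  by apply: measurable_fun_lee; apply: emeasurable_funD => //;
    exact: measurable_funeM.
have aeA : {ae mu, forall x,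
    (if below_average m kp kn (p x) (n x) then w x else 0%R)%:E = 0}.
  apply: ge0_integral_eq0_ae => //.
    by apply/measurable_EFinP; exact: measurable_fun_ifT.
  by move=> x; rewrite lee_fin; case: ifP.
have [iwp iwpE] := integral_fine mp p0 kpy.
have [iwn iwnE] := integral_fine mn n0 kny.
have mn' : measurable_fun setT (fun x => fine (n x)) by exact: measurableT_comp.
have mp' : measurable_fun setT (fun x => fine (p x)) by exact: measurableT_comp.
have wB x : (w x * (fine (p x) - fine (n x)) = w x * fine (p x) - w x * fine (n x))%R.
  by rewrite mulrBr.
apply: (@weighted_mean_not_lt _ _ _ mu w (fun x => fine (p x) - fine (n x))%R) => //.
- rewrite (_ : EFin \o _ =
      (fun x => (w x * fine (p x))%:E - (w x * fine (n x))%:E)); last first.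
    by apply/funext => x; rewrite /= wB EFinB.
  exact: integrableB.
- by rewrite gt_eqF.
have pfin : {ae mu, forall x, (w x)%:E * p x < +oo}.
  apply: ge0_integral_lty_ae => //; first exact: emeasurable_funM.
  by move=> x; rewrite mule_ge0// lee_fin.
have nfin : {ae mu, forall x, (w x)%:E * n x < +oo}.
  apply: ge0_integral_lty_ae => //; first exact: emeasurable_funM.
  by move=> x; rewrite mule_ge0// lee_fin.
apply: filterS3 aeA pfin nfin => x Ax px nx wx.
under eq_Rintegral do rewrite wB.
rewrite RintegralB//.
rewrite /Rintegral iwpE iwnE -/kp -/kn -/m.
have kp0 : 0 <= kp by apply: integral_ge0 => z _; rewrite mule_ge0// lee_fin.
have kn0 : 0 <= kn by apply: integral_ge0 => z _; rewrite mule_ge0// lee_fin.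
move: Ax px nx; case: (p x) (p0 x) => [px| |]//; last first.
  by rewrite gt0_muley ?lte_fin// ltxx.
case: (n x) (n0 x) => [nx| |]//; last first.
  by rewrite gt0_muley ?lte_fin// ltxx.
move=> _ _ + _ _; rewrite /below_average !ltry/=.
have mE : m = (fine m)%:E by rewrite fineK// ge0_fin_numE// ltW.
have kpE : kp = (fine kp)%:E by rewrite fineK// ge0_fin_numE.
have knE : kn = (fine kn)%:E by rewrite fineK// ge0_fin_numE.
rewrite [in X in X -> _]mE kpE knE/= -!EFinM -!EFinD lee_fin.
case: ifPn => [_ [wx0]|]; first by rewrite wx0 ltxx in wx.
by rewrite -ltNge => lt _; lra.
Qed.

End below_average.

(** * Improvement along the fibres *)

Section fibred_cost.
Context dS (S : measurableType dS) dP (P : measurableType dP) (R : realType).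
Variables (rho : {sigma_finite_measure set P -> \bar R}) (k : S * P -> R).
Hypotheses (mk : measurable_fun setT k) (k0 : forall x, 0 <= k x).
Implicit Types (c : R * P -> R) (s : S) (r : R).

(** One signed half of Gamma(s, r), with [c] the positive or the negative part of the cost. The
    halves stay separate so that every integral is one of a non-negative function. *)
Definition kernel_cost c s r : \bar R := (\int[rho]_p (c (r, p) * k (s, p))%:E)%E.

Let measurable_pair (f : R * P -> R) x : measurable_fun setT f ->
  measurable_fun setT (fun p => f (x, p)).
Proof. by move=> mf; apply: (measurableT_comp mf); exact: measurable_pair1. Qed.

Section one_cost.
Variable c : R * P -> R.
Hypotheses (mc : measurable_fun setT c) (c0 : forall x, 0 <= c x).

Lemma kernel_cost_ge0 s r : (0 <= kernel_cost c s r)%E.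
Proof. by apply: integral_ge0 => p _; rewrite lee_fin mulr_ge0. Qed.

Lemma measurable_kernel_cost dX (X : measurableType dX) (s : X -> S) (r : X -> R) :
  measurable_fun setT s -> measurable_fun setT r ->
  measurable_fun setT (fun x => kernel_cost c (s x) (r x)).
Proof.
move=> ms mr.
apply: (measurable_fun_fubini_tonelli_F
  (fun xp : X * P => (c (r xp.1, xp.2) * k (s xp.1, xp.2))%:E)).
- apply/measurable_EFinP; apply: measurable_funM.
  + apply: (measurableT_comp mc); apply: measurable_fun_pair => //=.
    exact: (measurableT_comp mr).
  + apply: (measurableT_comp mk); apply: measurable_fun_pair => //=.
    exact: (measurableT_comp ms).
- by move=> x; rewrite lee_fin mulr_ge0.
Qed.

Lemma measurable_kernel_cost_integrand s r :
  measurable_fun setT (fun p => (c (r, p) * k (s, p))%:E).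
Proof.
apply/measurable_EFinP; apply: measurable_funM; first exact: measurable_pair.
by apply: (measurableT_comp mk); exact: measurable_pair1.
Qed.

Lemma kernel_cost_eq0 s r :
  (\int[rho]_p (k (s, p))%:E = 0 -> kernel_cost c s r = 0)%E.
Proof.
move=> k_eq0; apply: ae0_ge0_integral.
- exact: measurable_kernel_cost_integrand.
- by move=> p; rewrite lee_fin mulr_ge0.
have : {ae rho, forall p, (k (s, p))%:E = 0%E}.
  apply: ge0_integral_eq0_ae => //.
    by apply/measurable_EFinP; apply: (measurableT_comp mk); exact: measurable_pair1.
  by move=> p; rewrite lee_fin.
by apply: filterS => p [->]; rewrite mulr0.
Qed.

End one_cost.

Variables cp cn : R * P -> R.
Hypotheses (mcp : measurable_fun setT cp) (cp0 : forall x, 0 <= cp x).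
Hypotheses (mcn : measurable_fun setT cn) (cn0 : forall x, 0 <= cn x).

(** This is the convexity inequality for [cp - cn], integrated against the non-negative kernel. The
    negative terms are moved across, so that possibly infinite quantities are only added. *)
Lemma kernel_cost_convex s (l r1 r2 r : R) : 0 <= l <= 1 ->
  (forall p, cp (r, p) + (l * cn (r1, p) + (1 - l) * cn (r2, p)) <=
             cn (r, p) + (l * cp (r1, p) + (1 - l) * cp (r2, p))) ->
  (kernel_cost cp s r +
     (l%:E * kernel_cost cn s r1 + (1 - l)%:E * kernel_cost cn s r2) <=
   kernel_cost cn s r +
     (l%:E * kernel_cost cp s r1 + (1 - l)%:E * kernel_cost cp s r2))%E.
Proof.
move=> /andP[l0 l1] convc; have l1' : 0 <= 1 - l by rewrite subr_ge0.
(* The two sides have the same shape with [cp] and [cn] exchanged, so one identity serves both. *)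
have combE (f g : R * P -> R) : measurable_fun setT f -> measurable_fun setT g ->
    (forall x, 0 <= f x) -> (forall x, 0 <= g x) ->
    (kernel_cost f s r + (l%:E * kernel_cost g s r1 + (1 - l)%:E * kernel_cost g s r2) =
    \int[rho]_p ((f (r, p) + (l * g (r1, p) + (1 - l) * g (r2, p))) * k (s, p))%:E)%E.
  move=> mf mg f0 g0.
  have mfk := measurable_kernel_cost_integrand mf s r.
  have mgk1 := measurable_kernel_cost_integrand mg s r1.
  have mgk2 := measurable_kernel_cost_integrand mg s r2.
  rewrite -!ge0_integralZl//; last 2 first.
  - by move=> p _; rewrite lee_fin mulr_ge0.
  - by move=> p _; rewrite lee_fin mulr_ge0.
  rewrite -!ge0_integralD//.
  - apply: eq_integral => p _; rewrite -!EFinM -!EFinD; congr EFin; ring.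
  all: try by move=> p _; rewrite ?adde_ge0 ?mule_ge0 ?lee_fin ?mulr_ge0.
  all: try exact: measurable_funeM.
  by apply: emeasurable_funD; exact: measurable_funeM.
have mcomb (f g : R * P -> R) : measurable_fun setT f -> measurable_fun setT g ->
    measurable_fun setT (fun p =>
      ((f (r, p) + (l * g (r1, p) + (1 - l) * g (r2, p))) * k (s, p))%:E).
  move=> mf mg; apply/measurable_EFinP; apply: measurable_funM => //.
    apply: measurable_funD; first exact: measurable_pair.
    by apply: measurable_funD; apply: measurable_funM => //; exact: measurable_pair.
  by apply: (measurableT_comp mk); exact: measurable_pair1.
rewrite !combE//; apply: ge0_le_integral => //.
- by move=> p _; rewrite lee_fin mulr_ge0// !addr_ge0// mulr_ge0.
- exact: mcomb.
- exact: mcomb.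
- by move=> p _; rewrite lee_fin ler_wpM2r.
Qed.

End fibred_cost.

Section below_average_point.
Context d (T : measurableType d) (R : realType) (mu : {measure set T -> \bar R}).
Variables (Q : set R) (gp gn : R -> \bar R) (w a : T -> R).
Hypotheses (mw : measurable_fun setT w) (w0 : forall x, 0 <= w x).
Hypotheses (ma : measurable_fun setT a) (Qa : forall x, 0 < w x -> Q (a x)).
Hypotheses (gp0 : forall r, (0 <= gp r)%E) (gn0 : forall r, (0 <= gn r)%E).
Hypotheses (mgp : measurable_fun setT (gp \o a)) (mgn : measurable_fun setT (gn \o a)).
Hypothesis convg : forall r1 r2 r, Q r1 -> Q r2 -> r1 <= r <= r2 ->
  Q r /\ exists2 l, 0 <= l <= 1 &
    (gp r + (l%:E * gn r1 + (1 - l)%:E * gn r2) <=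
     gn r + (l%:E * gp r1 + (1 - l)%:E * gp r2))%E.

Let m := (\int[mu]_x (w x)%:E)%E.
Let kp := (\int[mu]_x ((w x)%:E * gp (a x)))%E.
Let kn := (\int[mu]_x ((w x)%:E * gn (a x)))%E.

Hypotheses (m_gt0 : (0 < m)%E) (my : (m < +oo)%E).
Hypotheses (kpy : (kp < +oo)%E) (kny : (kn < +oo)%E).

Let wb x := if below_average m kp kn (gp (a x)) (gn (a x)) then w x else 0.

(** The weight [wb] has positive mass by [below_average_weight_neq0], so [b] lies between values
    [a x1] and [a x2] taken at below-average points. The bound at [b] is the convexity inequality
    scaled by [m], combined with the bounds at those points weighted by [l] and [1 - l]. *)
Lemma quasi_mean_below_average : let b := quasi_mean mu wb a in
  Q b /\ (m * gp b + kn <= m * gn b + kp)%E.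
Proof.
move=> b.
have wb0 x : 0 <= wb x by rewrite /wb; case: ifP.
have mwb : measurable_fun setT wb.
  apply: measurable_fun_ifT => //.
  apply: measurable_and; first exact: measurable_fun_lte.
  apply: measurable_and; first exact: measurable_fun_lte.
  by apply: measurable_fun_lee; apply: emeasurable_funD => //;
    exact: measurable_funeM.
have iwb : (\int[mu]_x (wb x)%:E < +oo)%E.
  apply: le_lt_trans my; apply: ge0_le_integral => //.
  - by move=> x _; rewrite lee_fin.
  - exact/measurable_EFinP.
  - exact/measurable_EFinP.
  - by move=> x _; rewrite lee_fin /wb; case: ifP.
have wbn0 : (\int[mu]_x (wb x)%:E != 0)%E.
  exact: (below_average_weight_neq0 (p := gp \o a) (n := gn \o a) mw w0
    mgp (fun x => gp0 (a x)) mgn (fun x => gn0 (a x)) m_gt0 my kpy kny).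
have wbE x : 0 < wb x -> Q (a x) /\ below_average m kp kn (gp (a x)) (gn (a x)).
  by rewrite /wb; case: ifP => [_ /Qa//|]; rewrite ltxx.
have [x1 /wbE[Q1 b1] le1] := le_quasi_mean mwb ma wb0 iwb wbn0.
have [x2 /wbE[Q2 b2] le2] := ge_quasi_mean mwb ma wb0 iwb wbn0.
have [|Qb [l /andP[l0 l1] cvl]] := convg Q1 Q2 (r := b); first by rewrite le1 le2.
split=> //.
have kp0 : (0 <= kp)%E by apply: integral_ge0 => z _; rewrite mule_ge0// lee_fin.
have kn0 : (0 <= kn)%E by apply: integral_ge0 => z _; rewrite mule_ge0// lee_fin.
have mE : m = (fine m)%:E by rewrite fineK// ge0_fin_numE// ltW.
have kpE : kp = (fine kp)%:E by rewrite fineK// ge0_fin_numE.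
have knE : kn = (fine kn)%:E by rewrite fineK// ge0_fin_numE.
have m0 : 0 < fine m by rewrite fine_gt0// m_gt0.
move: b1 b2 cvl; rewrite /below_average mE kpE knE.
move: (fine m) m0 (fine kp) (fine kn) => fm fm0 fkp fkn.
(* [below_average] excludes infinite values at [a x1] and [a x2]. *)
case: (gp (a x1)) (gp0 (a x1)) => [p1 _|_ /and3P[]|]//.
case: (gn (a x1)) (gn0 (a x1)) => [n1 _|_ /and3P[]|]//.
case: (gp (a x2)) (gp0 (a x2)) => [p2 _|_ _ /and3P[]|]//.
case: (gn (a x2)) (gn0 (a x2)) => [n2 _|_ _ /and3P[]|]//.
rewrite !ltry/= -!EFinM -!EFinD !lee_fin => h1 h2.
(* If [gn b] is infinite, the right-hand side is [+oo]. Otherwise the convexity inequality forces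
   [gp b] to be finite as well. *)
case: (gn b) (gn0 b) => [n _|_ _|//]; last first.
  by rewrite gt0_muley ?lte_fin// addye// leey.
case: (gp b) (gp0 b) => [p _|//|//].
rewrite -!EFinM -!EFinD !lee_fin => h.
have h1' := ler_wpM2l l0 h1.
have l1' : 0 <= 1 - l by rewrite subr_ge0.
have h2' := ler_wpM2l l1' h2.
have h' := ler_wpM2l (ltW fm0) h.
lra.
Qed.

End below_average_point.

Section fibrewise_improvement.
Context dS (S : measurableType dS) dZ (Z : measurableType dZ)
  dP (P : measurableType dP) (R : realType).
Variables (lam : {sigma_finite_measure set S -> \bar R})
  (zeta : {sigma_finite_measure set Z -> \bar R})
  (rho : {sigma_finite_measure set P -> \bar R}).
Variables (Q : set R) (q0 : R) (k : S * P -> R) (w a : S * Z -> R)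
  (cp cn : R * P -> R).
Hypotheses (Qq0 : Q q0).
Hypotheses (mk : measurable_fun setT k) (k0 : forall x, 0 <= k x).
Hypotheses (mw : measurable_fun setT w) (w0 : forall x, 0 <= w x).
Hypotheses (ma : measurable_fun setT a) (Qa : forall x, 0 < w x -> Q (a x)).
Hypotheses (mcp : measurable_fun setT cp) (cp0 : forall x, 0 <= cp x).
Hypotheses (mcn : measurable_fun setT cn) (cn0 : forall x, 0 <= cn x).
Hypothesis convc : forall r1 r2 r, Q r1 -> Q r2 -> r1 <= r <= r2 ->
  Q r /\ exists2 l, 0 <= l <= 1 &
    forall p, cp (r, p) + (l * cn (r1, p) + (1 - l) * cn (r2, p)) <=
              cn (r, p) + (l * cp (r1, p) + (1 - l) * cp (r2, p)).

(** The expected cost in the coordinates (s, z), for one signed part of the cost. *)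
Definition fibred_cost (c : R * P -> R) (b : S * Z -> R) : \bar R :=
  (\int[lam]_s \int[zeta]_z ((w (s, z))%:E * kernel_cost rho k c s (b (s, z))))%E.

Let m s := (\int[zeta]_z (w (s, z))%:E)%E.
Definition fibre_cost (c : R * P -> R) (b : S * Z -> R) s :=
  (\int[zeta]_z ((w (s, z))%:E * kernel_cost rho k c s (b (s, z))))%E.

Let msection (f : S * Z -> R) s : measurable_fun setT f ->
  measurable_fun setT (fun z => f (s, z)).
Proof. by move=> mf; apply: (measurableT_comp mf); exact: measurable_pair1. Qed.

Let mm : measurable_fun setT m.
Proof.
apply: (measurable_fun_fubini_tonelli_F (fun x => (w x)%:E)).
  exact/measurable_EFinP.
by move=> x; rewrite lee_fin.
Qed.

Section one_cost.
Variables (c : R * P -> R) (b : S * Z -> R).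
Hypotheses (mc : measurable_fun setT c) (c0 : forall x, 0 <= c x).
Hypothesis mb : measurable_fun setT b.

Let mwc : measurable_fun setT
  (fun x : S * Z => (w x)%:E * kernel_cost rho k c x.1 (b x))%E.
Proof.
apply: emeasurable_funM; first exact/measurable_EFinP.
exact: measurable_kernel_cost.
Qed.

Let wc_ge0 (x : S * Z) : (0 <= (w x)%:E * kernel_cost rho k c x.1 (b x))%E.
Proof. by rewrite mule_ge0 ?lee_fin// kernel_cost_ge0. Qed.

Lemma measurable_fibre_cost : measurable_fun setT (fibre_cost c b).
Proof. exact: (measurable_fun_fubini_tonelli_F _ mwc wc_ge0). Qed.

Let mwc_section s : measurable_fun setT
  (fun z => (w (s, z))%:E * kernel_cost rho k c s (b (s, z)))%E.
Proof. by apply: (measurableT_comp mwc); exact: measurable_pair1. Qed.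

Lemma fibre_cost_ge0 s : (0 <= fibre_cost c b s)%E.
Proof. by apply: integral_ge0 => z _; exact: (wc_ge0 (s, z)). Qed.

Lemma ae_fibre_cost_lty : (fibred_cost c b < +oo)%E -> 
  {ae lam, forall s, (fibre_cost c b s < +oo)%E}.
Proof.
by apply: ge0_integral_lty_ae;
  [exact: measurable_fibre_cost|exact: fibre_cost_ge0].
Qed.

Lemma fibre_cost_eq0 s : m s = 0%E -> fibre_cost c b s = 0%E.
Proof.
move=> ms0; apply: ae0_ge0_integral => //.
have : {ae zeta, forall z, (w (s, z))%:E = 0%E}.
  apply: ge0_integral_eq0_ae => //.
    by apply/measurable_EFinP; exact: msection.
  by move=> z; rewrite lee_fin.
by apply: filterS => z ->; rewrite mul0e.
Qed.

Lemma fibre_cost_eq0_kernel s :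
  (forall r, kernel_cost rho k c s r = 0)%E -> fibre_cost c b s = 0%E.
Proof.
by move=> c0s; apply: integral0_eq => z _; rewrite c0s mule0.
Qed.

End one_cost.

(** A decision depending on [s] alone has constant kernel cost on the fibre, which factors out of
    the integral over [z], even when the mass is infinite. *)
Lemma fibre_cost_fst (c : R * P -> R) (b : S -> R) s : (forall x, 0 <= c x) ->
  fibre_cost c (b \o fst) s = (m s * kernel_cost rho k c s (b s))%E.
Proof.
move=> c0; rewrite /m -ge0_integralZr//.
- by apply/measurable_EFinP; exact: msection.
- by move=> z _; rewrite lee_fin.
- exact: kernel_cost_ge0.
Qed.
(** Take the quasi-mean on each fibre. It is an explicit expression in integrals over [z], so
    Tonelli gives its measurability in [s] and no measurable selection argument is called for. *)
Lemma exists_fibrewise_selection : exists b : S -> R,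
  [/\ measurable_fun setT b, forall s, Q (b s) &
      forall s, (0 < m s < +oo -> fibre_cost cp a s < +oo ->
        fibre_cost cn a s < +oo ->
        fibre_cost cp (b \o fst) s + fibre_cost cn a s <=
        fibre_cost cn (b \o fst) s + fibre_cost cp a s)%E].
Proof.
pose kp := fibre_cost cp a; pose kn := fibre_cost cn a.
have mkp : measurable_fun setT kp by exact: measurable_fibre_cost.
have mkn : measurable_fun setT kn by exact: measurable_fibre_cost.
pose wb (x : S * Z) := if below_average (m x.1) (kp x.1) (kn x.1)
  (kernel_cost rho k cp x.1 (a x)) (kernel_cost rho k cn x.1 (a x))
  then w x else 0.
pose good s := [&& 0 < m s, m s < +oo, kp s < +oo & kn s < +oo]%E.
(* Off the [good] fibres the quasi-mean may leave [Q]; the default [q0] does not. *)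
pose b s := if good s
  then quasi_mean zeta (fun z => wb (s, z)) (fun z => a (s, z)) else q0.
have mwb : measurable_fun setT wb.
  have mcpa : measurable_fun setT (fun x : S * Z => kernel_cost rho k cp x.1 (a x)).
    exact: measurable_kernel_cost.
  have mcna : measurable_fun setT (fun x : S * Z => kernel_cost rho k cn x.1 (a x)).
    exact: measurable_kernel_cost.
  have mfst (f : S -> \bar R) : measurable_fun setT f ->
      measurable_fun setT (fun x : S * Z => f x.1).
    by move=> mf; exact: (measurableT_comp mf).
  apply: measurable_fun_ifT => //.
  apply: measurable_and; first exact: measurable_fun_lte.
  apply: measurable_and; first exact: measurable_fun_lte.
  apply: measurable_fun_lee; apply: emeasurable_funD; do ?exact: mfst;
    by apply: emeasurable_funM => //; exact: mfst.
have wb0 x : 0 <= wb x by rewrite /wb; case: ifP.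
have mgood : measurable_fun setT good.
  by do ?[apply: measurable_and]; exact: measurable_fun_lte.
(* Applied to [a] and to [- a], this covers the two logarithms in [quasi_mean]. *)
have mint (f : S * Z -> R) : measurable_fun setT f ->
    measurable_fun setT (fun s =>
      ln (fine (\int[zeta]_z (wb (s, z) * Num.min 1 (expR (f (s, z))))%:E)%E)).
  move=> mf; apply: (measurableT_comp (@measurable_ln R)).
  apply: measurableT_comp => //.
  apply: (measurable_fun_fubini_tonelli_F
    (fun x => (wb x * Num.min 1 (expR (f x)))%:E)).
    apply/measurable_EFinP; apply: measurable_funM => //.
    by apply: measurable_minr => //; exact: (measurableT_comp (@measurable_expR R)).
  by move=> x; rewrite lee_fin mulr_ge0// le_min ler01 expR_ge0.
have mb : measurable_fun setT b.
  apply: measurable_fun_ifT => //.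
  have mNa : measurable_fun setT (fun x => - a x) by exact: measurableT_comp.
  by rewrite /quasi_mean; exact: (measurable_funB (mint _ ma) (mint _ mNa)).
have goodP s : good s -> Q (b s) /\
    (m s * kernel_cost rho k cp s (b s) + kn s <=
     m s * kernel_cost rho k cn s (b s) + kp s)%E.
  rewrite /b => gs; rewrite gs; case/and4P : gs => m_gt0 my kpy kny.
  have := @quasi_mean_below_average _ _ _ zeta Q (kernel_cost rho k cp s)
    (kernel_cost rho k cn s) (fun z => w (s, z)) (fun z => a (s, z)).
  apply.
  - exact: msection.
  - by move=> z; exact: w0.
  - exact: msection.
  - by move=> z; exact: Qa.
  - by move=> r; exact: kernel_cost_ge0.
  - by move=> r; exact: kernel_cost_ge0.
  - by apply: measurable_kernel_cost => //; exact: msection.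
  - by apply: measurable_kernel_cost => //; exact: msection.
  - move=> r1 r2 r Q1 Q2 r12; have [Qr [l l01 convl]] := convc Q1 Q2 r12.
    by split=> //; exists l => //; exact: kernel_cost_convex.
  - exact: m_gt0.
  - exact: my.
  - exact: kpy.
  - exact: kny.
exists b; split; first exact: mb.
  by move=> s; have [/goodP[]|ngs] := boolP (good s); last rewrite /b (negbTE ngs).
move=> s /andP[m_gt0 my] kpy kny.
have gs : good s by rewrite /good m_gt0 my kpy kny.
have [_] := goodP s gs.
by rewrite (fibre_cost_fst _ _ cp0) (fibre_cost_fst _ _ cn0).
Qed.

(* A fibre of infinite mass is harmless: by [total_mass], the kernel vanishes
   almost everywhere on almost every such fibre. *)
Hypothesis total_mass : (fibred_cost (fun=> 1%R) a < +oo)%E.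
Hypotheses (cpy : (fibred_cost cp a < +oo)%E) (cny : (fibred_cost cn a < +oo)%E).

(** Integrate the inequality of [exists_fibrewise_selection] over [s]. Sums are compared instead of
    differences because the costs of [b] are not known to be finite at this point. *)
Lemma fibrewise_improvement : exists b : S -> R,
  [/\ measurable_fun setT b, forall s, Q (b s) &
      (fibred_cost cp (b \o fst) + fibred_cost cn a <=
       fibred_cost cn (b \o fst) + fibred_cost cp a)%E].
Proof.
have [b [mb Qb bP]] := exists_fibrewise_selection.
have mbf : measurable_fun setT (b \o fst : S * Z -> R).
  exact: (measurableT_comp mb).
have mcb (c : R * P -> R) : measurable_fun setT c -> (forall x, 0 <= c x) ->
    measurable_fun setT (fibre_cost c (b \o fst)).
  by move=> mc c0; exact: measurable_fibre_cost.
have cb0 (c : R * P -> R) s : (forall x, 0 <= c x) -> (0 <= fibre_cost c (b \o fst) s)%E.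
  by move=> c0; exact: fibre_cost_ge0.
have ca0 (c : R * P -> R) s : (forall x, 0 <= c x) -> (0 <= fibre_cost c a s)%E.
  by move=> c0; exact: fibre_cost_ge0.
have mca (c : R * P -> R) : measurable_fun setT c -> (forall x, 0 <= c x) ->
    measurable_fun setT (fibre_cost c a).
  by move=> mc c0; exact: measurable_fibre_cost.
exists b; split; [exact: mb|exact: Qb|].
have fcD (c c' : R * P -> R) : measurable_fun setT c -> measurable_fun setT c' ->
    (forall x, 0 <= c x) -> (forall x, 0 <= c' x) ->
    (fibred_cost c (b \o fst) + fibred_cost c' a =
     \int[lam]_s (fibre_cost c (b \o fst) s + fibre_cost c' a s))%E.
  move=> mc mc' c0 c0'; rewrite ge0_integralD; first by [].
  - exact: measurableT.
  - by move=> s _; exact: cb0.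
  - exact: mcb.
  - by move=> s _; exact: ca0.
  - exact: mca.
rewrite [leLHS](fcD _ _ mcp mcn cp0 cn0) [leRHS](fcD _ _ mcn mcp cn0 cp0).
apply: ae_ge0_le_integral.
- exact: measurableT.
- by move=> s _; rewrite adde_ge0// ?cb0// ca0.
- by apply: emeasurable_funD; [exact: mcb|exact: mca].
- by move=> s _; rewrite adde_ge0// ?cb0// ca0.
- by apply: emeasurable_funD; [exact: mcb|exact: mca].
have kpy := ae_fibre_cost_lty mcp cp0 ma cpy.
have kny := ae_fibre_cost_lty mcn cn0 ma cny.
have masy : {ae lam, forall s, (m s * \int[rho]_p (k (s, p))%:E < +oo)%E}.
  have m1 : measurable_fun setT (fun _ : R * P => 1 : R) by exact: measurable_cst.
  have := ae_fibre_cost_lty m1 (fun=> ler01) ma total_mass.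
  apply: filterS => s.
  (* At unit cost the decision is immaterial, so [a] can be replaced by a constant and
     [fibre_cost_fst] applies. *)
  rewrite -[fibre_cost _ _ _]/(fibre_cost (fun=> 1) ((fun=> q0) \o fst) s).
  rewrite fibre_cost_fst// /kernel_cost.
  by under eq_integral do rewrite mul1r.
apply: filterS3 kpy kny masy => s kpsy knsy massy _.
have [/bP->//|] := boolP (0 < m s < +oo)%E.
(* The remaining fibres have mass zero or [+oo]. In the second case [massy] forces the integral of
   the kernel to be zero. Both sides vanish either way. *)
rewrite negb_and -!leNgt leye_eq => /orP[m_le0|/eqP my].
  have ms0 : m s = 0%E.
    by apply/eqP; rewrite eq_le m_le0 integral_ge0// => z _; rewrite lee_fin.
  by rewrite !fibre_cost_eq0.
have ks0 : (\int[rho]_p (k (s, p))%:E = 0)%E.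
  apply/eqP; rewrite eq_le integral_ge0 ?andbT; last first.
    by move=> p _; rewrite lee_fin.
  rewrite leNgt; apply/negP => ks_gt0.
  by rewrite my gt0_mulye// ltxx in massy.
by rewrite !fibre_cost_eq0_kernel// => r; exact: kernel_cost_eq0.
Qed.

End fibrewise_improvement.

(** * Products of densities and iterated integrals *)

(** By induction on [n]: the measure on tuples is the image of a product measure under [tuple_cons],
    and Tonelli splits off the first factor. *)
Lemma integral_tuple_prod d (D : measurableType d) (R : realType)
    (nu : {sigma_finite_measure set D -> \bar R}) (p : D -> R) (n : nat) :
  measurable_fun setT p -> (forall x, 0 <= p x) -> (\int[nu]_x (p x)%:E = 1)%E ->
  (\int[tuple_measure nu n]_y (\prod_(i < n) p (tnth y i))%:E = 1)%E.
Proof.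
move=> mp p0 ip1.
have mprod k : measurable_fun setT
    (fun y : k.-tuple D => (\prod_(i < k) p (tnth y i))%:E).
  apply/measurable_EFinP; apply: measurable_prod => i _; apply: (measurableT_comp mp).
  exact: measurable_tnth.
have prod0 k (y : k.-tuple D) : 0 <= \prod_(i < k) p (tnth y i).
  exact: prodr_ge0.
elim: n => [|n IHn] /=.
  rewrite integral_dirac//; last exact: mprod.
  by rewrite diracT mul1e big_ord0.
transitivity (\int[pushforward (nu \x tuple_measure nu n)%E (@tuple_cons D n)]_y
    (\prod_(i < n.+1) p (tnth y i))%:E)%E; first by [].
rewrite ge0_integral_pushforward//.
- rewrite preimage_setT.
  transitivity (\int[nu \x tuple_measure nu n]_x
      ((p x.1)%:E * (\prod_(i < n) p (tnth x.2 i))%:E))%E.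
    apply: eq_integral => x _; rewrite /= big_ord_recl EFinM; congr (_ * _%:E)%E.
    by apply: eq_bigr => i _; rewrite /tuple_cons tnthS.
  rewrite fubini_tonelli1.
  + rewrite -[RHS]ip1; apply: eq_integral => x _.
    rewrite /fubini_F/= ge0_integralZl//.
    * by rewrite IHn mule1.
    * exact: mprod.
    * by move=> y _; rewrite lee_fin; exact: prod0.
    * by rewrite lee_fin.
  + apply: emeasurable_funM; last exact: (measurableT_comp (mprod n)).
    by apply/measurable_EFinP; exact: (measurableT_comp mp).
  + by move=> x; rewrite mule_ge0 ?lee_fin.
- exact: measurable_tuple_cons.
- exact: mprod.
- by move=> y _; rewrite lee_fin; exact: prod0.
Qed.

Section iterated_difference.
Local Open Scope ereal_scope.
Context d1 d2 (T1 : measurableType d1) (T2 : measurableType d2) (R : realType).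
Variables (m1 : {sigma_finite_measure set T1 -> \bar R})
  (m2 : {sigma_finite_measure set T2 -> \bar R}).

(** [ge0_integralB] is used twice: for the outer integrals, and for the inner ones at almost every
    [x], where the integral of [n (x, _)] is finite. *)
Lemma ge0_iterated_integralB (p n : T1 * T2 -> \bar R) :
  measurable_fun setT p -> measurable_fun setT n ->
  (forall x, 0 <= p x) -> (forall x, 0 <= n x) ->
  \int[m1]_x \int[m2]_y n (x, y) < +oo ->
  \int[m1]_x \int[m2]_y (p (x, y) - n (x, y)) =
  \int[m1]_x \int[m2]_y p (x, y) - \int[m1]_x \int[m2]_y n (x, y).
Proof.
move=> mp mn p0 n0 ny.
have mF (f : T1 * T2 -> \bar R) : measurable_fun setT f -> (forall x, 0 <= f x) ->
    measurable_fun setT (fun x => \int[m2]_y f (x, y)).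
  exact: measurable_fun_fubini_tonelli_F.
have F0 (f : T1 * T2 -> \bar R) x : (forall x, 0 <= f x) -> 0 <= \int[m2]_y f (x, y).
  by move=> f0; exact: integral_ge0.
have msec (f : T1 * T2 -> \bar R) x : measurable_fun setT f ->
    measurable_fun setT (fun y => f (x, y)).
  by move=> mf; apply: (measurableT_comp mf); exact: measurable_pair1.
rewrite -ge0_integralB; [|exact: mF|exact: mF|by move=> x; exact: F0
  |by move=> x; exact: F0|exact: ny].
have aeny : {ae m1, forall x, \int[m2]_y n (x, y) < +oo}.
  by apply: ge0_integral_lty_ae; [exact: mF|move=> x; exact: F0|].
apply: ae_eq_integral => //.
- have mpn : measurable_fun setT (fun z => p z - n z) by exact: emeasurable_funB.
  (* Measurability of the inner integral comes from Tonelli, which wants non-negative integrands, so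
     [p - n] is split into its parts. *)
  pose pos z := maxe (p z - n z) 0; pose neg z := maxe (- (p z - n z)) 0.
  rewrite (_ : (fun x => _) =
      (fun x => \int[m2]_y pos (x, y) - \int[m2]_y neg (x, y))); last first.
    apply/funext => x; rewrite integralE.
    by congr (_ - _); apply: eq_integral => y _; rewrite (funeposE, funenegE).
  apply: emeasurable_funB; apply: mF.
  + by apply: measurable_maxe.
  + by move=> z; rewrite /pos le_max lexx orbT.
  + by apply: measurable_maxe => //; exact: measurableT_comp.
  + by move=> z; rewrite /neg le_max lexx orbT.
- by apply: emeasurable_funB; exact: mF.
- apply: filterS aeny => x nxy _; apply: ge0_integralB => //; exact: msec.
Qed.

End iterated_difference.

(** * The data-driven model *)

Section product_sigma_finite.
Context d1 d2 (T1 : measurableType d1) (T2 : measurableType d2) (R : realType).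
Variables (m1 : {sigma_finite_measure set T1 -> \bar R})
  (m2 : {sigma_finite_measure set T2 -> \bar R}).

(* The canonical sigma-finite structure that the library puts on [m1 \x m2]
   requires finite factors. *)
Definition product_sigma_finite : set (T1 * T2) -> \bar R := (m1 \x m2)%E.

HB.instance Definition _ := Measure.on product_sigma_finite.

Let product_sigma_finiteT : sigma_finite setT product_sigma_finite.
Proof.
have /sigma_finiteP[F [FT ndF Fy]] := sigma_finiteT m1.
have /sigma_finiteP[G [GT ndG Gy]] := sigma_finiteT m2.
exists (fun n => F n `*` G n).
  apply/esym/seteqP; split=> // -[x y] _.
  have [i _ Fx] : (\bigcup_n F n) x by rewrite -FT.
  have [j _ Gx] : (\bigcup_n G n) y by rewrite -GT.
  exists (maxn i j) => //; split => /=.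
  - exact: (subsetPset _ _ (ndF _ _ (leq_maxl i j))).
  - exact: (subsetPset _ _ (ndG _ _ (leq_maxr i j))).
move=> n; have [mF Fny] := Fy n; have [mG Gny] := Gy n.
split; first exact: measurableX.
rewrite /product_sigma_finite product_measure1E//.
by rewrite lte_mul_pinfty// ge0_fin_numE.
Qed.

HB.instance Definition _ := Measure_isSigmaFinite.Build _ _ _
  product_sigma_finite product_sigma_finiteT.

End product_sigma_finite.

Lemma measurable_if0 d (T : measurableType d) (R : realType) (A : set T) (h : T -> R) :
  measurable A -> measurable_fun A h ->
  measurable_fun setT (fun x => if x \in A then h x else 0).
Proof. by move=> mA; move/(measurable_restrictT _ mA). Qed.

Section model.
Context (R : realType) (dD : measure_display) (D : measurableType dD)
  (nu : {sigma_finite_measure set D -> \bar R}) (o N : nat)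
  (Theta : set (Euclid R o)) (f : D -> Euclid R o -> R)
  (thetahat : N.-tuple D -> Euclid R o)
  (g0 : N.-tuple D -> R) (g1 : Euclid R o -> Euclid R o -> R)
  (W : set (Euclid R o * (N - o).-tuple D))
  (eta : Euclid R o * (N - o).-tuple D -> N.-tuple D)
  (J : Euclid R o * (N - o).-tuple D -> R)
  (u : Euclid R o -> R).

Let leb := Euclid_lebesgue R o.

Let rho : {sigma_finite_measure set (Euclid R o * D)%type -> \bar R} :=
  product_sigma_finite leb nu.

(** The density against which Gamma integrates the cost, at [v = (s, (t, x))]. It is extended by
    zero because its factors are controlled on [Theta] only. *)
Definition model_kernel (v : Euclid R o * (Euclid R o * D)) : R :=
  if v \in Theta `*` (Theta `*` setT)
  then g1 v.1 v.2.1 * f v.2.2 v.2.1 * u v.2.1 else 0.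

(** The weight [w] along the fibres, extended by zero off the coordinate domain [W]. *)
Definition fibre_weight (v : Euclid R o * (N - o).-tuple D) : R :=
  if v \in W then g0 (eta v) * J v else 0.

(** The functional [Psi] for a general cost [c], to be taken as a signed part of [C] or as the
    constant 1. *)
Definition cost_integral (c : R * (Euclid R o * D) -> R) (q : N.-tuple D -> R) : \bar R :=
  (\int[leb]_(t in Theta) \int[tuple_measure nu N]_y \int[nu]_x
     (c (q y, (t, x)) * (f x t * likelihood f y t * u t))%:E)%E.

Definition joint_integrand (c : R * (Euclid R o * D) -> R) (q : N.-tuple D -> R)
    (v : Euclid R o * N.-tuple D * D) : R :=
  c (q v.1.2, (v.1.1, v.2)) * (g0 v.1.2 * model_kernel (thetahat v.1.2, (v.1.1, v.2))).

Hypotheses (mTheta : measurable Theta)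
  (mf : measurable_fun ([set: D] `*` Theta) (fun p : D * Euclid R o => f p.1 p.2))
  (mthetahat : measurable_fun setT thetahat)
  (mg0 : measurable_fun setT g0)
  (mg1 : measurable_fun (Theta `*` Theta) (fun p : Euclid R o * Euclid R o => g1 p.1 p.2))
  (density_f : forall t, Theta t -> is_density nu setT (f ^~ t))
  (mle : is_MLE Theta f thetahat)
  (suff : sufficient_factorization Theta f thetahat g0 g1)
  (density_u : is_density leb Theta u)
  (reparam : reparametrization nu Theta thetahat W eta J).

Lemma measurable_model_kernel : measurable_fun setT model_kernel.
Proof.
have mE : measurable (Theta `*` (Theta `*` [set: D])).
  by apply: measurableX => //; exact: measurableX.
have m21 : measurable_fun setT (fun v : Euclid R o * (Euclid R o * D) => v.2.1).
  exact: (measurableT_comp measurable_fst).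
have m22 : measurable_fun setT (fun v : Euclid R o * (Euclid R o * D) => v.2.2).
  exact: (measurableT_comp measurable_snd).
have m121 : measurable_fun setT
    (fun v : Euclid R o * (Euclid R o * D) => (v.1, v.2.1)).
  exact: measurable_fun_pair.
have m221 : measurable_fun setT
    (fun v : Euclid R o * (Euclid R o * D) => (v.2.2, v.2.1)).
  exact: measurable_fun_pair.
have [mu _ _] := density_u.
apply: measurable_if0 => //; apply: measurable_funM; first apply: measurable_funM.
- have mTT : measurable (Theta `*` Theta) by exact: measurableX.
  have sub : (fun v : Euclid R o * (Euclid R o * D) => (v.1, v.2.1)) @`
      (Theta `*` (Theta `*` setT)) `<=` Theta `*` Theta.
    by move=> _ [[s [t x]] [/= ? [? _]] <-].
  exact: (measurable_comp mTT sub mg1 (measurable_funTS m121)).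
- have mDT : measurable ([set: D] `*` Theta) by exact: measurableX.
  have sub : (fun v : Euclid R o * (Euclid R o * D) => (v.2.2, v.2.1)) @`
      (Theta `*` (Theta `*` setT)) `<=` setT `*` Theta.
    by move=> _ [[s [t x]] [/= ? [? _]] <-].
  exact: (measurable_comp mDT sub mf (measurable_funTS m221)).
- have sub : (fun v : Euclid R o * (Euclid R o * D) => v.2.1) @`
      (Theta `*` (Theta `*` setT)) `<=` Theta.
    by move=> _ [[s [t x]] [/= ? [? _]] <-].
  exact: (measurable_comp mTheta sub mu (measurable_funTS m21)).
Qed.

Lemma model_kernel_ge0 v : 0 <= model_kernel v.
Proof.
rewrite /model_kernel; case: ifPn => //; rewrite inE; case: v => s [t x] /= [Ts [Tt _]].
have [_ u0 _] := density_u; have [_ f0 _] := density_f Tt; have [_ g10 _] := suff.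
by rewrite !mulr_ge0 ?g10 ?f0 ?u0.
Qed.

Lemma measurable_fibre_weight : measurable_fun setT fibre_weight.
Proof.
have [[mW _] meta _ mJ _ _] := reparam.
apply: measurable_if0 => //; apply: measurable_funM => //.
exact: (measurableT_comp mg0).
Qed.

Lemma fibre_weight_ge0 v : 0 <= fibre_weight v.
Proof.
rewrite /fibre_weight; case: ifPn => //; rewrite inE => Wv.
by have [g00 _ _] := suff; rewrite mulr_ge0// (jacobian_ge0 reparam).
Qed.

Section one_policy.
Variables (c : R * (Euclid R o * D) -> R) (q : N.-tuple D -> R).
Hypotheses (mc : measurable_fun setT c) (c0 : forall x, 0 <= c x).
Hypothesis mq : measurable_fun setT q.


Lemma measurable_joint_integrand : measurable_fun setT (joint_integrand c q).
Proof.
have m11 : measurable_fun setT (fun v : Euclid R o * N.-tuple D * D => v.1.1).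
  exact: (measurableT_comp measurable_fst).
have m12 : measurable_fun setT (fun v : Euclid R o * N.-tuple D * D => v.1.2).
  exact: (measurableT_comp measurable_snd).
have m112 : measurable_fun setT
    (fun v : Euclid R o * N.-tuple D * D => (v.1.1, v.2)).
  exact: measurable_fun_pair.
apply: measurable_funM; last apply: measurable_funM.
- apply: (measurableT_comp mc); apply: measurable_fun_pair => //.
  exact: (measurableT_comp mq).
- exact: (measurableT_comp mg0).
- apply: (measurableT_comp measurable_model_kernel).
  by apply: measurable_fun_pair => //; exact: (measurableT_comp mthetahat).
Qed.

Lemma joint_integrand_ge0 v : 0 <= joint_integrand c q v.
Proof.
have [g00 _ _] := suff.
by rewrite !mulr_ge0 ?model_kernel_ge0.
Qed.

(** Combines the factorization of the likelihood with [thetahat y] being in [Theta], which makes the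
    cut-off in [model_kernel] inactive. *)
Lemma joint_integrandE t y x : Theta t -> joint_integrand c q (t, y, x) =
  c (q y, (t, x)) * (f x t * likelihood f y t * u t).
Proof.
move=> Tt; have [_ _ ->//] := suff; have [Ty _] := mle y.
rewrite /joint_integrand /model_kernel /= mem_set//=; ring.
Qed.

Lemma joint_integrand_out t y x : ~ Theta t -> joint_integrand c q (t, y, x) = 0.
Proof.
move=> nTt; rewrite /joint_integrand /model_kernel /= memNset ?mulr0//.
by move=> [_ [/= ]].
Qed.

Lemma cost_integralE : cost_integral c q =
  (\int[leb]_t \int[tuple_measure nu N]_y \int[nu]_x
     (joint_integrand c q (t, y, x))%:E)%E.
Proof.
rewrite /cost_integral integral_mkcond; apply: eq_integral => t _.
rewrite patchE; case: ifPn; rewrite ?inE ?notin_setE => Tt.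
  apply: eq_integral => y _; apply: eq_integral => x _.
  by rewrite joint_integrandE.
rewrite (eq_integral (cst 0%E)) ?integral0// => y _.
by rewrite integral0_eq// => x _; rewrite joint_integrand_out.
Qed.

Let mEjoint : measurable_fun setT (EFin \o joint_integrand c q).
Proof. by apply/measurable_EFinP; exact: measurable_joint_integrand. Qed.

Let Ejoint_ge0 v : (0 <= (EFin \o joint_integrand c q) v)%E.
Proof. by rewrite lee_fin joint_integrand_ge0. Qed.

Lemma measurable_joint_integral : measurable_fun setT
  (fun ty => \int[nu]_x (joint_integrand c q (ty, x))%:E)%E.
Proof. exact: measurable_fun_fubini_tonelli_F mEjoint Ejoint_ge0. Qed.

Lemma joint_integral_ge0 ty : (0 <= \int[nu]_x (joint_integrand c q (ty, x))%:E)%E.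
Proof. by apply: integral_ge0 => x _; exact: Ejoint_ge0. Qed.

(** Tonelli brings the integral over [y] outside. Integrating over [(t, x)] leaves [h y], that is
    [g0 y] times the kernel cost at [(thetahat y, q y)], and the change of variables is applied to
    [h]. *)
Lemma cost_integral_fibred (b : Euclid R o * (N - o).-tuple D -> R) :
  (forall v, W v -> b v = q (eta v)) ->
  cost_integral c q = fibred_cost leb (tuple_measure nu (N - o)) rho
    model_kernel fibre_weight c b.
Proof.
move=> bE.
have [g00 _ _] := suff.
rewrite cost_integralE (fubini_tonelli
  (fun ty => \int[nu]_x (joint_integrand c q (ty, x))%:E)%E); first last.
- exact: joint_integral_ge0.
- exact: measurable_joint_integral.
have mk := measurable_model_kernel; have k0 := model_kernel_ge0.
pose h y := ((g0 y)%:E * kernel_cost rho model_kernel c (thetahat y) (q y))%E.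
have mh : measurable_fun setT h.
  by apply: emeasurable_funM; [exact/measurable_EFinP|exact: measurable_kernel_cost].
have h0 y : (0 <= h y)%E by rewrite mule_ge0 ?lee_fin// kernel_cost_ge0.
transitivity (\int[tuple_measure nu N]_y h y)%E.
  apply: eq_integral => y _; rewrite /h -ge0_integralZl//; first last.
  - by rewrite lee_fin.
  - by move=> p _; rewrite lee_fin mulr_ge0.
  - exact: measurable_kernel_cost_integrand.
  rewrite fubini_tonelli1.
  - apply: eq_integral => t _; apply: eq_integral => x _.
    by rewrite -EFinM /joint_integrand/=; congr EFin; ring.
  - by apply: measurable_funeM; exact: measurable_kernel_cost_integrand.
  - by move=> p; rewrite mule_ge0 ?lee_fin ?mulr_ge0.
rewrite (change_of_variables reparam mh h0) integral_mkcond /fibred_cost.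
have [mW sW] := reparam_dom reparam.
(* The restrictions to [Theta] and to the section of [W] are absorbed by [fibre_weight]; on the
   fibre over [t], [thetahat] equals [t]. *)
apply: eq_integral => t _; rewrite patchE; case: ifPn; rewrite ?inE ?notin_setE => Tt.
  rewrite integral_mkcond; apply: eq_integral => z _; rewrite patchE mem_xsection.
  rewrite /fibre_weight; case: ifPn; last by rewrite mul0e.
  rewrite inE => Wtz.
  have [fibE _ _] := reparam_fibre reparam Tt.
  have Etz : thetahat (eta (t, z)) = t by apply: fibE; rewrite /xsection/= inE.
  by rewrite /h Etz -(bE _ Wtz) EFinM muleAC.
rewrite integral0_eq// => z _; rewrite /fibre_weight memNset ?mul0e//.
by move=> /sW[].
Qed.

End one_policy.

(** Integrates the densities [f], the likelihood and [u] in turn; this supplies [total_mass]. *)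
Lemma cost_integral1 q : cost_integral (fun=> 1) q = 1%E.
Proof.
have [_ u0 iu] := density_u.
rewrite -[RHS]iu; apply: eq_integral => t; rewrite inE => Tt.
have [mft ft0 ift] := density_f Tt.
have L0 (y : N.-tuple D) : 0 <= likelihood f y t by apply: prodr_ge0 => n _; exact: ft0.
have mL : measurable_fun setT (fun y : N.-tuple D => (likelihood f y t)%:E).
  apply/measurable_EFinP; apply: measurable_prod => n _.
  by apply: (measurableT_comp mft); exact: measurable_tnth.
have mEf : measurable_fun setT (fun x => (f x t)%:E) by exact/measurable_EFinP.
transitivity (\int[tuple_measure nu N]_y ((u t)%:E * (likelihood f y t)%:E))%E.
  apply: eq_integral => y _.
  transitivity (\int[nu]_x ((u t * likelihood f y t)%:E * (f x t)%:E))%E.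
    by apply: eq_integral => x _; rewrite -EFinM; congr EFin; ring.
  rewrite ge0_integralZl; [|exact: measurableT|exact: mEf| |].
  - by rewrite ift mule1 EFinM.
  - by move=> x _; rewrite lee_fin ft0.
  - by rewrite lee_fin mulr_ge0// u0.
rewrite ge0_integralZl//; first last.
- by rewrite lee_fin u0.
- by move=> y _; rewrite lee_fin.
rewrite (integral_tuple_prod N mft _ ift) ?mule1// => x.
exact: ft0.
Qed.

(** * Splitting the cost into its positive and negative parts *)

Section decomposition.
Variables (Q : set R) (C : R -> D -> R).
Hypotheses (mQ : measurable Q)
  (mC : measurable_fun (Q `*` [set: D]) (fun p : R * D => C p.1 p.2)).

(** The value off [Q] is set to zero, since the cost is assumed measurable on [Q] only. *)
Definition cost_part (c : R -> D -> R) (v : R * (Euclid R o * D)) : R :=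
  if v \in Q `*` setT then Num.max (c v.1 v.2.2) 0 else 0.

Definition cost_pos := cost_part C.
Definition cost_neg := cost_part (fun r x => - C r x).

Lemma cost_part_ge0 c v : 0 <= cost_part c v.
Proof. by rewrite /cost_part; case: ifP => // _; rewrite le_max lexx orbT. Qed.

Lemma measurable_cost_part c :
  measurable_fun (Q `*` [set: D]) (fun p : R * D => c p.1 p.2) ->
  measurable_fun setT (cost_part c).
Proof.
move=> mc; have mQD : measurable (Q `*` [set: Euclid R o * D]) by exact: measurableX.
apply: measurable_if0 => //; apply: measurable_maxr => //.
have m122 : measurable_fun setT
    (fun v : R * (Euclid R o * D) => (v.1, v.2.2)).
  apply: measurable_fun_pair => //.
  exact: (measurableT_comp measurable_snd).
have mQD' : measurable (Q `*` [set: D]) by exact: measurableX.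
have sub : (fun v : R * (Euclid R o * D) => (v.1, v.2.2)) @` (Q `*` setT) `<=`
    Q `*` [set: D].
  by move=> _ [[r [t x]] [/= ? _] <-].
exact: (measurable_comp mQD' sub mc (measurable_funTS m122)).
Qed.

Lemma measurable_cost_pos : measurable_fun setT cost_pos.
Proof. exact: measurable_cost_part. Qed.

Lemma measurable_cost_neg : measurable_fun setT cost_neg.
Proof. by apply: measurable_cost_part; exact: measurableT_comp. Qed.

Variable q : N.-tuple D -> R.
Hypothesis pq : prescriptive Q q.

Let weight_ge0 t (y : N.-tuple D) x : Theta t -> 0 <= f x t * likelihood f y t * u t.
Proof.
move=> Tt; have [_ u0 _] := density_u; have [_ f0 _] := density_f Tt.
by rewrite !mulr_ge0 ?u0 ?f0// prodr_ge0// => n _; exact: f0.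
Qed.

Let Psi_integrandE t y x : Psi_integrand f C u q t y x =
  C (q y) x * (f x t * likelihood f y t * u t).
Proof. by rewrite /Psi_integrand !mulrA. Qed.

Let inQ t y x : (q y, (t, x)) \in Q `*` [set: Euclid R o * D].
Proof. by rewrite inE; split => //=; have [_] := pq. Qed.

Lemma cost_integral_neg : Psi_well_defined nu Theta f C u q ->
  (cost_integral cost_neg q < +oo)%E.
Proof.
move=> wd; apply: le_lt_trans wd; rewrite le_eqVlt; apply/orP; left; apply/eqP.
apply: eq_integral => t; rewrite inE => Tt.
apply: eq_integral => y _; apply: eq_integral => x _.
rewrite Psi_integrandE /cost_neg /cost_part inQ /= -mulNr.
by rewrite -[in RHS](mul0r (f x t * likelihood f y t * u t)) maxr_pMl// weight_ge0.
Qed.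

(** The innermost integral is by definition the difference of those of the two parts. The outer two
    recombine by [ge0_iterated_integralB], for which finiteness of the negative part suffices. *)
Lemma Psi_decomposition : (cost_integral cost_neg q < +oo)%E ->
  Psi nu Theta f C u q = (cost_integral cost_pos q - cost_integral cost_neg q)%E.
Proof.
have [mq _] := pq.
have mp := measurable_cost_pos; have mn := measurable_cost_neg.
have p0 v : 0 <= cost_pos v by exact: cost_part_ge0.
have n0 v : 0 <= cost_neg v by exact: cost_part_ge0.
rewrite !cost_integralE => ny.
rewrite -(ge0_iterated_integralB (measurable_joint_integral mp p0 mq)
  (measurable_joint_integral mn n0 mq) (joint_integral_ge0 q p0)
  (joint_integral_ge0 q n0) ny).
rewrite /Psi integral_mkcond; apply: eq_integral => t _.
rewrite patchE; case: ifPn; rewrite ?inE ?notin_setE => Tt; last first.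
  rewrite integral0_eq// => y _; rewrite !integral0_eq ?sube0//.
  - by move=> x _; rewrite joint_integrand_out.
  - by move=> x _; rewrite joint_integrand_out.
apply: eq_integral => y _; rewrite integralE; congr (_ - _)%E.
- apply: eq_integral => x _; rewrite funeposE -EFin_max joint_integrandE//.
  rewrite Psi_integrandE /cost_pos /cost_part inQ /=.
  by rewrite -[in LHS](mul0r (f x t * likelihood f y t * u t)) maxr_pMl// weight_ge0.
- apply: eq_integral => x _; rewrite funenegE -EFinN -EFin_max joint_integrandE//.
  rewrite Psi_integrandE /cost_neg /cost_part inQ /= -mulNr.
  by rewrite -[in LHS](mul0r (f x t * likelihood f y t * u t)) maxr_pMl// weight_ge0.
Qed.

End decomposition.

End model.

(** * Convexity on the real line *)

Section convexity.
Context (R : realType) (Q : set R).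
Hypothesis convQ : convex_set (Q : set (convex_lmodType R^o)).

Lemma convex_set_conv (l r1 r2 : R) : 0 <= l <= 1 -> Q r1 -> Q r2 ->
  Q (l * r1 + (1 - l) * r2).
Proof.
move=> /andP[l0 l1] Q1 Q2.
by have := convQ (Itv01 l0 l1) (mem_set Q1) (mem_set Q2); rewrite inE.
Qed.

Lemma between_conv (r1 r2 r : R) : r1 <= r <= r2 ->
  exists2 l, 0 <= l <= 1 & r = l * r1 + (1 - l) * r2.
Proof.
move=> /andP[r1r rr2]; have [r12|r21] := ltP r1 r2; last first.
  (* Here [r1 = r = r2], and the quotient used below would have denominator zero. *)
  exists 1; first by rewrite ler01 lexx.
  by rewrite mul1r subrr mul0r addr0; apply/eqP; rewrite eq_le r1r (le_trans rr2).
have d0 : 0 < r2 - r1 by rewrite subr_gt0.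
exists ((r2 - r) / (r2 - r1)); last by field; rewrite gt_eqF.
by rewrite divr_ge0 ?subr_ge0 ?(ltW r12)//= ler_pdivrMr// mul1r lerB.
Qed.

Lemma measurable_convex_set : measurable Q.
Proof.
apply: is_interval_measurable => r1 r2 Q1 Q2 r /between_conv[l l01 ->].
exact: convex_set_conv.
Qed.

(** Writing each positive part as the value plus the negative part, the negative parts cancel and
    the convexity of [c] remains. *)
Lemma convex_function_parts (c : R -> R) (r1 r2 r : R) :
  convex_function (Q : set (convex_lmodType R^o)) c ->
  Q r1 -> Q r2 -> forall l, 0 <= l <= 1 -> r = l * r1 + (1 - l) * r2 ->
  Num.max (c r) 0 +
    (l * Num.max (- c r1) 0 + (1 - l) * Num.max (- c r2) 0) <=
  Num.max (- c r) 0 + (l * Num.max (c r1) 0 + (1 - l) * Num.max (c r2) 0).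
Proof.
move=> cc Q1 Q2 l /andP[l0 l1] rE.
have h : c r <= l * c r1 + (1 - l) * c r2.
  by rewrite rE; exact: (cc (Itv01 l0 l1) _ _ (mem_set Q1) (mem_set Q2)).
have partsE (x : R) : Num.max x 0 = x + Num.max (- x) 0.
  by have [x0|x0] := leP x 0; [rewrite max_l ?oppr_ge0// subrr
    |rewrite max_r ?oppr_le0 ?(ltW x0)// addr0].
rewrite (partsE (c r)) (partsE (c r1)) (partsE (c r2)).
lra.
Qed.

End convexity.

(** * From an optimal policy to an optimal policy through the estimator *)

Theorem theorem2 (R : realType) (dD : measure_display) (D : measurableType dD)
    (nu : {sigma_finite_measure set D -> \bar R})
    (o N : nat) (oN : (o <= N)%N)
    (Q : set R) (C : R -> D -> R)
    (Theta : set (Euclid R o)) (f : D -> Euclid R o -> R)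
    (thetahat : N.-tuple D -> Euclid R o)
    (g0 : N.-tuple D -> R) (g1 : Euclid R o -> Euclid R o -> R)
    (W : set (Euclid R o * (N - o).-tuple D))
    (eta : Euclid R o * (N - o).-tuple D -> N.-tuple D)
    (J : Euclid R o * (N - o).-tuple D -> R)
    (u : Euclid R o -> R)
    (* measurability of the data *)
    (mC : measurable_fun (Q `*` [set: D]) (fun p : R * D => C p.1 p.2))
    (mTheta : measurable Theta)
    (mf : measurable_fun ([set: D] `*` Theta) (fun p : D * Euclid R o => f p.1 p.2))
    (mthetahat : measurable_fun setT thetahat)
    (mg0 : measurable_fun setT g0)
    (mg1 : measurable_fun (Theta `*` Theta) (fun p : Euclid R o * Euclid R o => g1 p.1 p.2))
    (* the model, the estimator and the localization *)
    (density_f : forall t, Theta t -> is_density nu setT (f ^~ t))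
    (mle : is_MLE Theta f thetahat)
    (suff : sufficient_factorization Theta f thetahat g0 g1)
    (density_u : is_density (Euclid_lebesgue R o) Theta u)
    (* the integrals are well defined, and the minimization has a solution *)
    (wdPsi : forall q : N.-tuple D -> R, prescriptive Q q -> Psi_well_defined nu Theta f C u q)
    (exopt : exists q : N.-tuple D -> R, locally_optimal nu Theta f C Q u q)
    (* convexity and re-parametrization *)
    (convQ : convex_set (Q : set (convex_lmodType R^o)))
    (convC : forall x, convex_function (Q : set (convex_lmodType R^o)) (C ^~ x))
    (reparam : reparametrization nu Theta thetahat W eta J) :
  exists q : N.-tuple D -> R,
    MLE_sufficient Theta Q thetahat q /\ locally_optimal nu Theta f C Q u q.

Proof.
have [qopt [[mqopt Qqopt] qoptP]] := exopt.
(* If there are no data points, [qopt] is vacuously a function of the estimator. Otherwise [y0]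
   yields a point of [Q]. *)
have [[y0]|noy] := pselect (inhabited (N.-tuple D)); last first.
  exists qopt; split; last by [].
  split; first by [].
  exists (cst 0); first exact: measurable_cst.
  by move=> y; exfalso; apply: noy; exact: inhabits.
pose q0 := qopt y0.
have Qq0 : Q q0 by exact: Qqopt.
have mQ := measurable_convex_set convQ.
pose cp := cost_pos (D := D) (o := o) Q C; pose cn := cost_neg (D := D) (o := o) Q C.
have mcp : measurable_fun setT cp by exact: measurable_cost_pos.
have mcn : measurable_fun setT cn by exact: measurable_cost_neg.
have cp0 v : 0 <= cp v by exact: cost_part_ge0.
have cn0 v : 0 <= cn v by exact: cost_part_ge0.
have cny (q : N.-tuple D -> R) (pq : prescriptive Q q) :
    (cost_integral nu Theta f u cn q < +oo)%E.
  exact: (cost_integral_neg density_f density_u pq (wdPsi q pq)).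
have PsiE (q : N.-tuple D -> R) (pq : prescriptive Q q) : Psi nu Theta f C u q =
    (cost_integral nu Theta f u cp q - cost_integral nu Theta f u cn q)%E.
  exact: (Psi_decomposition mTheta mf mthetahat mg0 mg1 density_f mle suff
    density_u mQ mC pq (cny q pq)).
have popt : prescriptive Q qopt by split.
(* If the optimal value is [+oo], every policy is optimal and a constant one will do. *)
have [Psiy|] := ltP (Psi nu Theta f C u qopt) +oo%E; last first.
  rewrite leye_eq => /eqP Psiy; exists (fun=> q0).
  have pq0 : prescriptive Q (fun _ : N.-tuple D => q0).
    by split; [exact: measurable_cst|].
  split; first by split; [exact: pq0|exists (cst q0); [exact: measurable_cst|]].
  by split; [exact: pq0|move=> q' /qoptP; rewrite Psiy; apply: le_trans; exact: leey].
have mk := measurable_model_kernel mTheta mf mg1 density_u.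
have k0 := model_kernel_ge0 density_f suff density_u.
have mw := measurable_fibre_weight mg0 reparam.
have w0 := fibre_weight_ge0 suff reparam.
pose V := fibred_cost (Euclid_lebesgue R o) (tuple_measure nu (N - o))
  (product_sigma_finite (Euclid_lebesgue R o) nu)
  (model_kernel Theta f g1 u) (fibre_weight g0 W eta J).
have VE (c : R * (Euclid R o * D) -> R) (q : N.-tuple D -> R) b
    (mc : measurable_fun setT c) (c0 : forall v, 0 <= c v)
    (mq : measurable_fun setT q) (bE : forall v, W v -> b v = q (eta v)) :
    cost_integral nu Theta f u c q = V c b.
  exact: (cost_integral_fibred mTheta mf mthetahat mg0 mg1 density_f mle suff
    density_u reparam mc c0 mq bE).
(* [qopt] in the new coordinates. The value 0 off [W] need not be in [Q], but [fibre_weight]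
   vanishes there. *)
pose a (v : Euclid R o * (N - o).-tuple D) := if v \in W then qopt (eta v) else 0.
have aE v : W v -> a v = qopt (eta v) by move=> Wv; rewrite /a mem_set.
have [[mW sW] meta _ _ _ _] := reparam.
have ma : measurable_fun setT a.
  by apply: measurable_if0 => //; exact: (measurableT_comp mqopt).
have Qa v : 0 < fibre_weight g0 W eta J v -> Q (a v).
  by rewrite /fibre_weight /a; case: ifP => // _; rewrite ltxx.
have m1 : measurable_fun setT (fun _ : R * (Euclid R o * D) => 1 : R).
  exact: measurable_cst.
have V1y : (V (fun=> 1%R) a < +oo)%E.
  by rewrite -(VE _ _ _ m1 (fun=> ler01) mqopt aE) cost_integral1// ltry.
have Vny : (V cn a < +oo)%E by rewrite -(VE _ _ _ mcn cn0 mqopt aE); exact: cny.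
(* The negative part is finite, so an infinite positive part would make the optimal value
   infinite. *)
have Vpy : (V cp a < +oo)%E.
  rewrite -(VE _ _ _ mcp cp0 mqopt aE) ltey; apply: contraTneq Psiy => cpy.
  rewrite (PsiE _ popt) cpy addye ?ltxx//.
  by rewrite eqe_oppLR lt_eqF// (cny _ popt).
have convcpn r1 r2 r : Q r1 -> Q r2 -> r1 <= r <= r2 ->
    Q r /\ exists2 l, 0 <= l <= 1 & forall p,
      cp (r, p) + (l * cn (r1, p) + (1 - l) * cn (r2, p)) <=
      cn (r, p) + (l * cp (r1, p) + (1 - l) * cp (r2, p)).
  move=> Q1 Q2 /between_conv[l l01 rE].
  have Qr : Q r by rewrite rE; exact: convex_set_conv.
  split=> //; exists l => // p.
  have inQ r' : Q r' -> (r', p) \in Q `*` [set: Euclid R o * D].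
    by move=> Qr'; rewrite inE.
  rewrite /cp /cn /cost_pos /cost_neg /cost_part !inQ//=.
  exact: (convex_function_parts (convC p.2)).
have [b [mb Qb bV]] := fibrewise_improvement Qq0 mk k0 mw w0 ma Qa mcp cp0 mcn cn0
  convcpn V1y Vpy Vny.
have pb : prescriptive Q (b \o thetahat).
  by split; [exact: (measurableT_comp mb)|move=> y; exact: Qb].
(* [eta (t, z)] lies on the fibre of the estimator over [t]. *)
have bE v : W v -> (b \o fst) v = (b \o thetahat) (eta v).
  case: v => t z Wtz /=; have [Tt _] := sW _ Wtz.
  have [fibE _ _] := reparam_fibre reparam Tt.
  by congr b; apply/esym/fibE; rewrite /xsection/= inE.
exists (b \o thetahat); split.
  by split; [exact: pb|exists b; [exact: measurable_funTS|]].
split; first exact: pb.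
move=> q' /qoptP; apply: le_trans.
rewrite (PsiE _ pb) (PsiE _ popt).
have := cny _ pb; have := cny _ popt.
rewrite (VE _ _ _ mcp cp0 pb.1 bE) (VE _ _ _ mcn cn0 pb.1 bE).
rewrite (VE _ _ _ mcp cp0 mqopt aE) (VE _ _ _ mcn cn0 mqopt aE).
have V0 c d : (forall v, 0 <= c v) -> (0 <= V c d)%E.
  move=> c0; apply: integral_ge0 => s _; apply: integral_ge0 => z _.
  by rewrite mule_ge0 ?lee_fin ?w0// kernel_cost_ge0.
(* Of the four costs only [V cp (b \o fst)] is not yet known to be finite, and [bV] bounds it by
   finite ones; the subtractions are then real. *)
move: bV; rewrite -/V.
move: (V cp (b \o fst)) (V cn a) (V cn (b \o fst)) (V cp a) (V0 _ (b \o fst) cp0)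
  (V0 _ a cn0) (V0 _ (b \o fst) cn0) (V0 _ a cp0) Vpy.
move=> [x| |] [y| |] [z| |] [t| |]//=; rewrite ?lee_fin; lra.
Qed.
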